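(* Let $k,\ell$ be positive integers and consider the system of two rational difference equations $$x_{n}=\frac{\beta_{k}x_{n-k} +\gamma_{k}y_{n-k}}{1+\sum_{j=1}^{\ell}B_{j}x_{n-j} + \sum_{j=1}^{\ell}C_{j}y_{n-j}},\qquad y_{n}=\frac{\delta_{k}x_{n-k} +\epsilon_{k}y_{n-k}}{1+\sum_{j=1}^{\ell}D_{j}x_{n-j} + \sum_{j=1}^{\ell}E_{j}y_{n-j}},\qquad n\in\mathbb{N},$$ with nonnegative real parameters $\beta_k,\gamma_k,\delta_k,\epsilon_k,B_j,C_j,D_j,E_j$ and nonnegative real initial conditions. Assume $B_{j}=C_{j}=D_{j}=E_{j}=0$ for every $j\in\{1,\dots,\ell\}$ that is a multiple of $k$ (i.e. $j=k,2k,3k,\dots$). Define $$A=\begin{pmatrix}\beta_{k} & \gamma_{k}\\ \delta_{k} & \epsilon_{k}\end{pmatrix}.$$ Then the system exhibits the following tetrachotomy behavior. (I) If the spectral radius of $A$ is less than $1$, then every solution converges to the zero equilibrium. (II) If the spectral radius of $A$ is equal to $1$, every eigenvalue $\lambda$ of $A$ with $|\lambda|=1$ has algebraic multiplicity equal to its geometric multiplicity, and $-1$ is not an eigenvalue of $A$, then every solution converges to a periodic solution of not necessarily prime period $k$. Furthermore, in this case there exist periodic solutions with prime period $k$. (III) If the spectral radius of $A$ is equal to $1$, every eigenvalue $\lambda$ of $A$ with $|\lambda|=1$ has algebraic multiplicity equal to its geometric multiplicity, and $-1$ is an eigenvalue of $A$, then every solution converges to a periodic solution of not necessarily prime period $2k$.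 Furthermore, in this case there exist periodic solutions with prime period $2k$. (IV) If the spectral radius of $A$ is greater than $1$, or the spectral radius of $A$ is equal to $1$ and $A$ has an eigenvalue $\lambda$ with $|\lambda|=1$ whose algebraic multiplicity exceeds its geometric multiplicity, then there exist solutions for which the sequence $x_{n}+y_{n}$ is unbounded.
   Context: $\mathbb{N}=\{1,2,3,\dots\}$. Initial conditions are the values $(x_n,y_n)\in[0,\infty)^2$ for $1-\max(k,\ell)\le n\le 0$; they determine a unique solution $\{(x_n,y_n)\}$ through the recursion for $n\ge 1$. A solution is periodic of not necessarily prime period $p$ if $(x_{n+p},y_{n+p})=(x_n,y_n)$ for all $n$ (the least period may be a proper divisor of $p$); it has prime period $p$ if $p$ is the least positive integer with this property. A solution $\{(x_n,y_n)\}$ converges to a periodic solution $\{(\tilde x_n,\tilde y_n)\}$ if $(x_n,y_n)-(\tilde x_n,\tilde y_n)\to(0,0)$ as $n\to\infty$. The zero equilibrium is the constant solution $(0,0)$. *)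

(* Defs.v *)
From HB Require Import structures.
From mathcomp Require Import all_boot all_order all_algebra.
From mathcomp Require Import complex.
From mathcomp Require Import all_classical all_reals all_analysis.
Set Implicit Arguments.
Unset Strict Implicit.
Unset Printing Implicit Defensive.
Import Order.TTheory GRing.Theory Num.Theory.
Import numFieldNormedType.Exports.
Local Open Scope classical_set_scope.
Local Open Scope ring_scope.
Local Open Scope complex_scope.

(* A solution is a pair of functions x, y : int -> R; only the values at the
   indices n >= 1 - max(k, l) are meaningful, and every notion below looks at
   those indices only. *)
Definition first_index (k l : nat) : int := 1 - (maxn k l)%:Z.

Definition is_solution (R : realType) (k l : nat)
    (beta gamma delta eps : R) (B C D E : nat -> R) (x y : int -> R) : Prop :=
  (forall n : int, first_index k l <= n <= 0 -> 0 <= x n /\ 0 <= y n) /\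
  (forall n : int, 1 <= n ->
     x n = (beta * x (n - k%:Z) + gamma * y (n - k%:Z)) /
           (1 + \sum_(1 <= j < l.+1) B j * x (n - j%:Z)
              + \sum_(1 <= j < l.+1) C j * y (n - j%:Z)) /\
     y n = (delta * x (n - k%:Z) + eps * y (n - k%:Z)) /
           (1 + \sum_(1 <= j < l.+1) D j * x (n - j%:Z)
              + \sum_(1 <= j < l.+1) E j * y (n - j%:Z))).

Definition has_period (R : realType) (k l p : nat) (x y : int -> R) : Prop :=
  forall n : int, first_index k l <= n ->
    x (n + p%:Z) = x n /\ y (n + p%:Z) = y n.

Definition has_prime_period (R : realType) (k l p : nat) (x y : int -> R) :
    Prop :=
  [/\ (0 < p)%N, has_period k l p x y &
      forall q : nat, (0 < q)%N -> has_period k l q x y -> (p <= q)%N].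

Definition converges_to (R : realType) (x y x' y' : int -> R) : Prop :=
  (fun n : nat => x n%:Z - x' n%:Z) @ \oo --> (0 : R) /\
  (fun n : nat => y n%:Z - y' n%:Z) @ \oo --> (0 : R).

Definition unbounded_sum (R : realType) (k l : nat) (x y : int -> R) : Prop :=
  ~ bounded_set [set x n + y n | n in [set n : int | first_index k l <= n]].

Definition mx22 (R : realType) (a b c d : R) : 'M[R]_2 :=
  \matrix_(i < 2, j < 2)
    if i == 0 then (if j == 0 then a else b) else (if j == 0 then c else d).

(* Eigenvalues of a real matrix are taken over R[i]. *)
Definition complexify (R : realType) (n : nat) (A : 'M[R]_n) : 'M[R[i]]_n :=
  map_mx (real_complex R) A.

Definition spectral_radius (R : realType) (n : nat) (A : 'M[R]_n) : R :=
  sup [set complex.Re `|lam| |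
         lam in [set lam : R[i] | eigenvalue (complexify A) lam]].

Definition alg_mult (R : realType) (n : nat) (A : 'M[R]_n) (lam : R[i]) : nat :=
  mup lam (char_poly (complexify A)).

(* eigenspace is spanned by row eigenvectors (u *m A = lam *: u), hence the
   transpose, which gives the space of column eigenvectors of A. *)
Definition geom_mult (R : realType) (n : nat) (A : 'M[R]_n) (lam : R[i]) : nat :=
  \rank (eigenspace (complexify A)^T lam).

(* Main.v *)
Require Import Defs.
From HB Require Import structures.
From mathcomp Require Import all_boot all_order all_algebra.
From mathcomp Require Import complex.
From mathcomp Require Import all_classical all_reals all_analysis.
From mathcomp Require Import ring lra zify.
Set Implicit Arguments.
Unset Strict Implicit.
Unset Printing Implicit Defensive.
Import Order.TTheory GRing.Theory Num.Theory.
Import numFieldNormedType.Exports.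
Local Open Scope classical_set_scope.
Local Open Scope ring_scope.
Local Open Scope complex_scope.

(* Along each residue class mod k the system reads V_n = D_n A V_(n-k) with D_n
   diagonal and entries in (0, 1], so V_n <= A V_(n-k) and positive left
   eigenvectors of A give Lyapunov functions.  Both eigenvalues r1 >= |r2| of the
   nonnegative matrix A are real, and the spectral radius is r1.
   - If r1 < 1, the form w with w (I - A) a positive multiple of (1, 1) decreases
     by at least a multiple of x + y at each step.
   - If r1 = 1 and r2 = -1, then A^2 = I, so x and y decrease along the classes
     mod 2k.
   - If r1 = 1 and A = I, then x and y decrease along the classes mod k.
   - If r1 = 1, |r2| < 1 and A has a positive left 1-eigenvector w, then w V
     converges along each class, hence V_n - A V_(n-k) -> 0 and V converges.
   - Otherwise, up to exchanging x and y, beta = 1, gamma = 0 and eps < 1: x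
     decreases, and y is driven by x.  Comparing the upper and lower limits of y
     at a class where their ratio is largest shows that they agree.
   The periodic and unbounded solutions are supported on the multiples of k, where
   all denominators are 1 and the system is the linear recursion V_n = A V_(n-k). *)

(** * Convergence criteria and tail bounds for real sequences *)

Section real_sequences.
Variable R : realType.
Implicit Types (u v c h : R^nat).

Lemma near_nonincreasing_ge0_cvgn u : (\forall i \near \oo, 0 <= u i) ->
  (\forall i \near \oo, u i.+1 <= u i) -> cvgn u.
Proof.
move=> u0 uS; have [N _ uN] := filterI u0 uS.
apply/cvg_ex; exists (inf (range [sequence u (n + N)%N]_n)).
rewrite -(cvg_shiftn N); apply: nonincreasing_cvgn.
  by apply/nonincreasing_seqP => n; have [] := uN (n + N)%N (leq_addl _ _).
by exists 0 => _ [n _ <-]; have [] := uN (n + N)%N (leq_addl _ _).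
Qed.

Lemma cvgn_diffS0 u : cvgn u -> (fun i => u i - u i.+1) @ \oo --> (0 : R).
Proof.
move=> cu; rewrite -(subrr (limn u)); apply: cvgB => //.
by rewrite (cvg_shiftS u).
Qed.

Lemma contraction_cvg0 (q : R) c h : 0 <= q < 1 -> (forall i, 0 <= c i) ->
  h @ \oo --> (0 : R) -> (\forall i \near \oo, c i.+1 <= q * c i + h i) ->
  c @ \oo --> (0 : R).
Proof.
move=> /andP[q0 q1] c0 h0 cS; apply/cvgrPdist_lt => e e0.
(* With this bound on [h], the map [t |-> q * t + e * (1 - q) / 2] has fixed point [e / 2], which is
   what the induction for [cN] carries along. *)
have e'0 : 0 < e * (1 - q) / 2 by rewrite divr_gt0// mulr_gt0// subr_gt0.
move/cvgrPdist_lt : h0 => /(_ _ e'0) h0.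
have [N _ HN] := filterI h0 cS.
have cN i : c (i + N)%N <= q ^+ i * c N + e / 2.
  elim: i => [|i IH]; first by rewrite expr0 mul1r add0n lerDl ltW// divr_gt0.
  have [] := HN (i + N)%N (leq_addl _ _); rewrite /= sub0r normrN => hi ci.
  rewrite addSn (le_trans ci)//.
  have hle : h (i + N)%N <= e * (1 - q) / 2.
    by rewrite (le_trans (ler_norm _))// ltW.
  rewrite (le_trans (lerD (ler_wpM2l q0 IH) hle))// exprS.
  by rewrite le_eqVlt; apply/orP; left; apply/eqP; field.
have : (fun i => q ^+ i * c N) @ \oo --> (0 * c N : R).
  by apply: cvgMl; apply: cvg_expr; rewrite ger0_norm.
rewrite mul0r => /cvgrPdist_lt /(_ (e / 2)); rewrite divr_gt0// => /(_ isT).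
move=> [M _ HM]; exists (M + N)%N => // i /= MNi.
have Ni : (N <= i)%N by rewrite (leq_trans (leq_addl _ _) MNi).
have := HM (i - N)%N; rewrite /= leq_subRL// addnC => /(_ MNi).
have := cN (i - N)%N; rewrite subnK// !sub0r !normrN.
rewrite (ger0_norm (c0 _)) (ger0_norm (mulr_ge0 (exprn_ge0 _ q0) (c0 N))).
lra.
Qed.

(** The distance from [u] to the fixed point [L] of the limiting recursion contracts by [|q|], up to
    the vanishing error [|v - limn v|]. *)
Lemma affine_recurrence_cvg (q : R) u v : `|q| < 1 -> cvgn v ->
  (\forall i \near \oo, u i.+1 = q * u i + v i) -> cvgn u.
Proof.
move=> q1 cv uS; have q1' : 1 - q != 0.
  by rewrite subr_eq0 eq_sym; apply: contraTneq q1 => ->; rewrite normr1 ltxx.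
set L := limn v / (1 - q); apply/cvg_ex; exists L; apply/subr_cvg0/norm_cvg0P.
apply: (@contraction_cvg0 `|q| _ (fun i => `|v i - limn v|)).
- by rewrite normr_ge0.
- by move=> i; exact: normr_ge0.
- rewrite -(@normr0 R R); apply: cvg_norm; rewrite -(subrr (limn v)).
  by apply: cvgB => //; exact: cvg_cst.
- apply: filterS uS => i ->; rewrite -normrM (le_trans _ (ler_normD _ _))//.
  rewrite le_eqVlt; apply/orP; left; apply/eqP; congr (`|_|).
  by rewrite /L; field.
Qed.

Lemma near_bounded_range u a b :
  (\forall i \near \oo, a <= u i <= b) ->
  has_lbound (range u) /\ has_ubound (range u).
Proof.
move=> [N _ HN].
have Hu i : `|u i| <= `|a| + `|b| + \sum_(j < N) `|u j|.
  have [Ni|iN] := leqP N i.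
    have /andP[ai ib] := HN i Ni.
    rewrite (@le_trans _ _ (`|a| + `|b|))// ?lerDl ?sumr_ge0//.
    move: ai ib (ler_norm b) (lerNnormlW (lexx `|a|)) (normr_ge0 a) (normr_ge0 b).
    by rewrite ler_norml; lra.
  rewrite (bigD1 (Ordinal iN))//= addrCA lerDl !addr_ge0//.
  by rewrite sumr_ge0.
split; [exists (- (`|a| + `|b| + \sum_(j < N) `|u j|))|
        exists (`|a| + `|b| + \sum_(j < N) `|u j|)] => _ [i _ <-].
  by have := Hu i; rewrite ler_norml => /andP[].
by have := Hu i; rewrite ler_norml => /andP[].
Qed.

Lemma sups_ge u i j : has_ubound (range u) -> (i <= j)%N -> u j <= sups u i.
Proof.
by move=> uu ij; apply: ub_le_sup; [exact: has_ubound_sdrop|exists j].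
Qed.

Lemma infs_le u i j : has_lbound (range u) -> (i <= j)%N -> infs u i <= u j.
Proof.
by move=> uu ij; apply: ge_inf; [exact: has_lbound_sdrop|exists j].
Qed.

Lemma sups_le u i b : (forall j, (i <= j)%N -> u j <= b) -> sups u i <= b.
Proof.
move=> ub; apply: ge_sup; first by exists (u i); exists i => /=.
by move=> _ [j /= ij <-]; exact: ub.
Qed.

Lemma infs_ge u i b : (forall j, (i <= j)%N -> b <= u j) -> b <= infs u i.
Proof.
move=> ub; apply: lb_le_inf; first by exists (u i); exists i => /=.
by move=> _ [j /= ij <-]; exact: ub.
Qed.

Lemma near_all_ge (P : set nat) : (\forall i \near \oo, P i) ->
  \forall i \near \oo, forall j, (i <= j)%N -> P j.
Proof.
by move=> [N _ HN]; exists N => // i /= Ni j ij; exact/HN/(leq_trans Ni).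
Qed.

End real_sequences.

(** * Subsequences along residue classes and periodic functions on the integers *)

Section periodic_subsequences.
Variable R : realType.
Implicit Types (p i : nat) (n c : int) (f : int -> R).

(** The base point [n] is any integer, so early terms may lie where a solution is meaningless; this
    is why later facts about [along] hold only eventually. *)
Definition along p f n : R^nat := fun i => f (n + (i * p)%N%:Z).

Lemma near_along_ge p n c : (0 < p)%N ->
  \forall i \near \oo, c <= n + (i * p)%N%:Z.
Proof.
move=> p0; exists `|c - n|%N => // i /= ci.
have : (i <= i * p)%N by rewrite leq_pmulr.
lia.
Qed.

Lemma alongS p f n i : along p f n i.+1 = f (n + p%:Z + (i * p)%N%:Z).
Proof. by rewrite /along mulSn PoszD addrA. Qed.

Lemma along_addp p f n : along p f (n + p%:Z) = fun i => along p f n i.+1.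
Proof. by apply/funext => i; rewrite alongS. Qed.

(** There are only [p] residue classes, so one threshold [N] serves them all, and an index of at
    least [N * p] has quotient at least [N]. *)
Lemma along_cvg0 p f : (0 < p)%N ->
  (forall n, along p f n @ \oo --> (0 : R)) ->
  (fun n : nat => f n%:Z) @ \oo --> (0 : R).
Proof.
move=> p0 f0; apply/cvgrPdist_lt => e e0.
have : \forall i \near \oo, forall r : 'I_p, `|0 - along p f (val r)%:Z i| < e.
  by apply: filter_forall => r; move/cvgrPdist_lt : (f0 (val r)%:Z); exact.
move=> [N _ HN]; exists (N * p)%N => // n /= Npn.
have := HN (n %/ p)%N; rewrite /= leq_divRL// => /(_ Npn).
move=> /(_ (Ordinal (ltn_pmod n p0))); rewrite /along /= -PoszD addnC.
by rewrite -divn_eq.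
Qed.

Lemma periodic_shift p f : (forall n, f (n + p%:Z) = f n) ->
  forall n i, f (n + (i * p)%N%:Z) = f n.
Proof.
move=> fp n; elim=> [|i IH]; first by rewrite mul0n addr0.
by rewrite mulSn PoszD addrCA addrC fp IH.
Qed.

Lemma periodic_modz p f : (0 < p)%N -> (forall n, f (n + p%:Z) = f n) ->
  forall n, f n = f (n %% p%:Z)%Z.
Proof.
move=> p0 fp n; rewrite {1}(divz_eq n p%:Z) addrC.
case: (n %/ p%:Z)%Z => q; first by rewrite -PoszM periodic_shift.
rewrite NegzE -(periodic_shift fp _ q.+1) mulNr PoszM.
by rewrite -addrA addNr addr0.
Qed.

Lemma periodic_attains_max p f : (0 < p)%N ->
  (forall n, f (n + p%:Z) = f n) -> exists n0, forall n, f n <= f n0.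
Proof.
move=> p0 fp; have [r _ rmax] := @arg_maxP _ R 'I_p (Ordinal p0) predT
  (fun r => f (val r)%:Z) isT.
exists (val r)%:Z => n; rewrite (periodic_modz p0 fp).
have np : (`|(n %% p%:Z)%Z| < p)%N.
  by rewrite -ltz_nat gez0_abs ?modz_ge0 ?ltz_pmod//; case: p p0 {fp r rmax}.
have := rmax (Ordinal np) isT; rewrite /= gez0_abs//.
by rewrite modz_ge0//; case: p p0 {fp r rmax np}.
Qed.

End periodic_subsequences.

(** This symmetry transfers results between the two coordinates, so each convergence result is
    proved for one of them only. *)
Lemma is_solution_swap (R : realType) (k l : nat) (beta gamma delta eps : R)
    (B C D E : nat -> R) (x y : int -> R) :
  is_solution k l beta gamma delta eps B C D E x y ->
  is_solution k l eps delta gamma beta E D C B y x.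
Proof.
move=> [init recur]; split=> n hn; first by have [] := init n hn.
have [-> ->] := recur n hn.
by split; rewrite [X in X / _ = _]addrC [X in _ / X = _]addrAC.
Qed.

(** * Denominators and the comparison of periodic envelopes *)

Section solutions.
Variables (R : realType) (k l : nat) (beta gamma delta eps : R).
Variables (B C D E : nat -> R).
Hypotheses (k_gt0 : (0 < k)%N).
Hypotheses (beta_ge0 : 0 <= beta) (gamma_ge0 : 0 <= gamma).
Hypotheses (delta_ge0 : 0 <= delta) (eps_ge0 : 0 <= eps).
Hypothesis BCDE_ge0 : forall j : nat, (1 <= j <= l)%N ->
  [/\ 0 <= B j, 0 <= C j, 0 <= D j & 0 <= E j].

Local Notation solution := (is_solution k l beta gamma delta eps B C D E).
Local Notation first := (first_index k l).

Definition den (P Q : nat -> R) (x y : int -> R) (n : int) : R :=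
  1 + \sum_(1 <= j < l.+1) P j * x (n - j%:Z)
    + \sum_(1 <= j < l.+1) Q j * y (n - j%:Z).

Lemma den_ge1 (P Q : nat -> R) (x y : int -> R) (n : int) :
  (forall j : nat, (1 <= j <= l)%N -> 0 <= P j /\ 0 <= Q j) ->
  (forall j : nat, (1 <= j <= l)%N -> 0 <= x (n - j%:Z) /\ 0 <= y (n - j%:Z)) ->
  1 <= den P Q x y n.
Proof.
move=> PQ xy; rewrite /den -addrA lerDl addr_ge0//.
  rewrite big_nat sumr_ge0// => j jl.
  by have [? _] := PQ j jl; have [? _] := xy j jl; exact: mulr_ge0.
rewrite big_nat sumr_ge0// => j jl.
by have [_ ?] := PQ j jl; have [_ ?] := xy j jl; exact: mulr_ge0.
Qed.

Lemma den_cvg (P Q : nat -> R) (X Y : nat -> int -> R) (x y : int -> R)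
    (n : int) :
  (forall m, X i m @[i --> \oo] --> x m) ->
  (forall m, Y i m @[i --> \oo] --> y m) ->
  den P Q (X i) (Y i) n @[i --> \oo] --> den P Q x y n.
Proof.
move=> cx cy; apply: cvgD; first apply: cvgD; first exact: cvg_cst.
- apply: cvg_big => [|j _]; first exact: add_continuous.
  by apply: cvgMr; exact: cx.
- apply: cvg_big => [|j _]; first exact: add_continuous.
  by apply: cvgMr; exact: cy.
Qed.

Lemma along_den (P Q : nat -> R) (x y : int -> R) (p : nat) (n : int) (i : nat) :
  along p (den P Q x y) n i =
  den P Q ((along p x)^~ i) ((along p y)^~ i) n.
Proof.
rewrite /along /den; congr (1 + _ + _); apply: eq_bigr => j _;
  by rewrite addrAC.
Qed.

Lemma le_den (P Q : nat -> R) (x y x' y' : int -> R) (n : int) :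
  (forall j : nat, (1 <= j <= l)%N -> 0 <= P j /\ 0 <= Q j) ->
  (forall j : nat, (1 <= j <= l)%N -> x (n - j%:Z) <= x' (n - j%:Z)) ->
  (forall j : nat, (1 <= j <= l)%N -> y (n - j%:Z) <= y' (n - j%:Z)) ->
  den P Q x y n <= den P Q x' y' n.
Proof.
move=> PQ xx' yy'; apply: lerD; first apply: lerD => //; rewrite !big_nat;
  apply: ler_sum => j jl; apply: ler_wpM2l.
- by case: (PQ j jl).
- exact: xx'.
- by case: (PQ j jl).
- exact: yy'.
Qed.

Lemma BC_ge0 (j : nat) : (1 <= j <= l)%N -> 0 <= B j /\ 0 <= C j.
Proof. by case/BCDE_ge0. Qed.

Lemma DE_ge0 (j : nat) : (1 <= j <= l)%N -> 0 <= D j /\ 0 <= E j.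
Proof. by case/BCDE_ge0. Qed.

(** At a class [n0] where the ratio of [M] to [m] takes its largest value [c], the bound
    [M <= c * m] makes the [E]-sum over [M] times [m n0] at most the [E]-sum over [m] times [M n0].
    The two inequalities then leave [M n0 * Q n0 <= m n0 * Q n0], so [c <= 1]. In the application
    [m] and [M] are the lower and upper limits of [y], and [P] is its forcing by [x]. *)
Lemma envelope_collapse (P Q m M : int -> R) :
  (forall n, M (n + k%:Z) = M n) -> (forall n, m (n + k%:Z) = m n) ->
  (forall n, 0 <= m n <= M n) -> (forall n, 0 < Q n) ->
  (forall n, M n * (Q n + \sum_(1 <= j < l.+1) E j * m (n - j%:Z)) <= P n) ->
  (forall n, P n <= m n * (Q n + \sum_(1 <= j < l.+1) E j * M (n - j%:Z))) ->
  forall n, m n = M n.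
Proof.
move=> Mk mk mM Q0 upper lower.
have m0 n : 0 <= m n by case/andP: (mM n).
have M0 n : 0 <= M n by case/andP: (mM n) => /le_trans; exact.
have sum_ge0 (f : int -> R) n : (forall n, 0 <= f n) ->
    0 <= \sum_(1 <= j < l.+1) E j * f (n - j%:Z).
  move=> f0; rewrite big_nat sumr_ge0// => j jl.
  by apply: mulr_ge0 => //; case: (DE_ge0 jl).
(* Where [m] vanishes, the two inequalities bound a positive multiple of [M n] by 0, so [M <= c * m]
   will hold there as well. *)
have M_eq0 n : m n = 0 -> M n = 0.
  move=> mn0; apply/eqP; rewrite eq_le M0 andbT.
  rewrite -(@pmulr_lle0 _ (Q n + \sum_(1 <= j < l.+1) E j * m (n - j%:Z))).
    by rewrite (le_trans (upper n))// (le_trans (lower n))// mn0 mul0r.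
  by rewrite ltr_wpDr// sum_ge0.
(* [c] is the largest ratio [M / m]; the junk value [0 / 0 = 0] is harmless. *)
have [n0 n0max] : exists n0, forall n, M n / m n <= M n0 / m n0.
  by apply: periodic_attains_max k_gt0 _ => n; rewrite Mk mk.
set c := M n0 / m n0 in n0max.
have Mc n : M n <= c * m n.
  have [/M_eq0 ->|mn0] := eqVneq (m n) 0.
    by rewrite mulr_ge0// divr_ge0.
  by rewrite -ler_pdivrMr// lt0r mn0 m0.
have c1 : c <= 1.
  rewrite leNgt; apply/negP => c1.
  have mn0 : m n0 != 0.
    by apply: contraTneq c1 => mn0; rewrite /c mn0 invr0 mulr0 ltr10.
  have Mn0 : M n0 = c * m n0 by rewrite /c divfK.
  have : M n0 * Q n0 <= m n0 * Q n0.
    have := le_trans (upper n0) (lower n0); rewrite !mulrDr => H.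
    have : m n0 * (\sum_(1 <= j < l.+1) E j * M (n0 - j%:Z)) <=
           M n0 * (\sum_(1 <= j < l.+1) E j * m (n0 - j%:Z)).
      rewrite Mn0 -mulrA mulrCA ler_wpM2l// mulr_sumr !big_nat.
      apply: ler_sum => j jl; rewrite mulrCA ler_wpM2l//.
      by case: (DE_ge0 jl).
    by move: H; lra.
  rewrite ler_pM2r// Mn0 ger_pMl ?lt0r ?mn0 ?m0//.
  by rewrite leNgt c1.
move=> n; apply/eqP; rewrite eq_le; case/andP: (mM n) => _ ->/=.
by rewrite (le_trans (Mc n))// ler_piMl.
Qed.

Lemma first_le_sub (n : int) (j : nat) :
  1 <= n -> (j <= maxn k l)%N -> first <= n - j%:Z.
Proof. by rewrite /first_index; lia. Qed.

(** * Nonnegativity, linear bounds and convergence for a single solution *)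

Section one_solution.
Variables x y : int -> R.
Hypothesis sol : solution x y.

Lemma solution_ge0 (n : int) : first <= n -> 0 <= x n /\ 0 <= y n.
Proof.
have [init recur] := sol.
(* Strong induction through an upper bound [m], since the recursion reaches back up to [maxn k l]
   indices. *)
suff H (m : nat) : forall n : int, n <= m%:Z -> first <= n -> 0 <= x n /\ 0 <= y n.
  by move=> fn; apply: (H `|n|%N) => //; lia.
elim: m => [|m IH] {}n nm fn; first by apply: init; rewrite fn.
have [n0|n1] := leP n 0; first by apply: init; rewrite fn.
have {}n1 : 1 <= n by lia.
have prev j : (1 <= j <= maxn k l)%N ->
    0 <= x (n - j%:Z) /\ 0 <= y (n - j%:Z).
  by move=> jkl; apply: IH; [lia|apply: first_le_sub => //; lia].
have [|xk yk] := prev k; first lia.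
have prevl j : (1 <= j <= l)%N -> 0 <= x (n - j%:Z) /\ 0 <= y (n - j%:Z).
  by move=> jl; apply: prev; lia.
have [-> ->] := recur n n1; split; apply: divr_ge0.
- by rewrite addr_ge0// mulr_ge0.
- exact: le_trans (den_ge1 BC_ge0 prevl).
- by rewrite addr_ge0// mulr_ge0.
- exact: le_trans (den_ge1 DE_ge0 prevl).
Qed.

Lemma solution_prev_ge0 (n : int) (j : nat) : 1 <= n -> (j <= maxn k l)%N ->
  0 <= x (n - j%:Z) /\ 0 <= y (n - j%:Z).
Proof. by move=> n1 jkl; apply: solution_ge0; exact: first_le_sub. Qed.

Lemma solution_den_ge1 (n : int) : 1 <= n ->
  1 <= den B C x y n /\ 1 <= den D E x y n.
Proof.
move=> n1; have prev j : (1 <= j <= l)%N ->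
    0 <= x (n - j%:Z) /\ 0 <= y (n - j%:Z).
  by move=> jl; apply: solution_prev_ge0 => //; lia.
by split; apply: den_ge1 => //; [exact: BC_ge0|exact: DE_ge0].
Qed.

Lemma solution_le (n : int) : 1 <= n ->
  x n <= beta * x (n - k%:Z) + gamma * y (n - k%:Z) /\
  y n <= delta * x (n - k%:Z) + eps * y (n - k%:Z).
Proof.
move=> n1; have [xk yk] := solution_prev_ge0 n1 (leq_maxl k l).
have [d1 d2] := solution_den_ge1 n1.
have [-> ->] := sol.2 n n1; split; rewrite ler_pdivrMr ?(lt_le_trans ltr01)//.
  by rewrite ler_peMr// addr_ge0// mulr_ge0.
by rewrite ler_peMr// addr_ge0// mulr_ge0.
Qed.

Lemma near_along_solution (n : int) : \forall i \near \oo,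
  [/\ 0 <= along k x n i, 0 <= along k y n i,
      along k x n i.+1 <= beta * along k x n i + gamma * along k y n i &
      along k y n i.+1 <= delta * along k x n i + eps * along k y n i].
Proof.
apply: filterS (near_along_ge n 1 k_gt0) => i n1.
have [x0 y0] := @solution_ge0 (n + (i * k)%N%:Z) ltac:(rewrite /first_index; lia).
have n1' : 1 <= n + k%:Z + (i * k)%N%:Z by lia.
have := solution_le n1'; rewrite -!alongS.
by rewrite [n + k%:Z + _]addrAC addrK => -[? ?]; split.
Qed.

(** The classwise limits are the periodic solution sought: the recursion at [n + i * p] passes to
    the limit in [i] because the limiting denominators are at least 1. *)
Lemma solution_cvg_periodic (p : nat) : (0 < p)%N ->
  (forall n, cvgn (along p x n)) -> (forall n, cvgn (along p y n)) ->
  exists x' y' : int -> R,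
    [/\ solution x' y', has_period k l p x' y' & converges_to x y x' y'].
Proof.
move=> p0 cx cy.
pose x' n := limn (along p x n); pose y' n := limn (along p y n).
have x'p n : x' (n + p%:Z) = x' n.
  by apply/cvg_lim => //; rewrite along_addp (cvg_shiftS (along p x n)); exact: cx.
have y'p n : y' (n + p%:Z) = y' n.
  by apply/cvg_lim => //; rewrite along_addp (cvg_shiftS (along p y n)); exact: cy.
have x'0 n : 0 <= x' n.
  apply: limr_ge; first exact: cx.
  apply: filterS (near_along_ge n 1 p0) => i n1.
  by apply: (solution_ge0 _).1; rewrite /first_index; lia.
have y'0 n : 0 <= y' n.
  apply: limr_ge; first exact: cy.
  apply: filterS (near_along_ge n 1 p0) => i n1.
  by apply: (solution_ge0 _).2; rewrite /first_index; lia.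
have den_neq0 P Q n :
    (forall j : nat, (1 <= j <= l)%N -> 0 <= P j /\ 0 <= Q j) ->
    den P Q x' y' n != 0.
  by move=> PQ; rewrite gt_eqF// (lt_le_trans ltr01)// den_ge1.
have rec_lim (z : int -> R) (P Q : nat -> R) (a b : R) :
    (forall j : nat, (1 <= j <= l)%N -> 0 <= P j /\ 0 <= Q j) ->
    (forall n : int, 1 <= n ->
      z n = (a * x (n - k%:Z) + b * y (n - k%:Z)) / den P Q x y n) ->
    (forall n, cvgn (along p z n)) ->
    forall n, limn (along p z n) =
      (a * x' (n - k%:Z) + b * y' (n - k%:Z)) / den P Q x' y' n.
  move=> PQ zE cz n.
  have H : (fun i => (a * along p x (n - k%:Z) i + b * along p y (n - k%:Z) i)
      / along p (den P Q x y) n i) @ \oo -->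
      (a * x' (n - k%:Z) + b * y' (n - k%:Z)) / den P Q x' y' n.
    apply: cvgM; last first.
      apply: cvgV; first exact: den_neq0.
      by under eq_cvg do rewrite along_den; exact: den_cvg.
    by apply: cvgD; apply: cvgMr; [exact: cx|exact: cy].
  apply/cvg_lim => //; apply: cvg_trans H; apply: near_eq_cvg.
  apply: filterS (near_along_ge n 1 p0) => i n1.
  by rewrite /along zE// [n - _ + _]addrAC.
exists x', y'; split.
- split=> n _; first by split; [exact: x'0|exact: y'0].
  split.
    exact: (rec_lim x B C beta gamma BC_ge0 (fun m h => (sol.2 m h).1) cx).
  exact: (rec_lim y D E delta eps DE_ge0 (fun m h => (sol.2 m h).2) cy).
- by move=> n _; split; [exact: x'p|exact: y'p].
- split.
    apply: (@along_cvg0 R p (fun n => x n - x' n)) => // n.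
    rewrite (_ : along _ _ _ = fun i => along p x n i - x' n).
      by apply/subr_cvg0; exact: cx.
    by apply/funext => i; rewrite /along (periodic_shift x'p).
  apply: (@along_cvg0 R p (fun n => y n - y' n)) => // n.
  rewrite (_ : along _ _ _ = fun i => along p y n i - y' n).
    by apply/subr_cvg0; exact: cy.
  by apply/funext => i; rewrite /along (periodic_shift y'p).
Qed.

(** The three inequalities encode spectral radius below 1. The nonnegative [s] decreases, so its
    decrements tend to 0, and they dominate [Delta] times each coordinate. *)
Lemma solution_cvg0 : beta < 1 -> eps < 1 ->
  gamma * delta < (1 - beta) * (1 - eps) ->
  converges_to x y (fun=> 0) (fun=> 0).
Proof.
move=> beta1 eps1; rewrite -subr_gt0; set Delta := _ - _ => Delta_gt0.
(* [(w1, w2) A = (w1, w2) - Delta (1, 1)] *)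
pose w1 := 1 - eps + delta; pose w2 := 1 - beta + gamma.
have w10 : 0 < w1 by rewrite ltr_wpDr// subr_gt0.
have w20 : 0 < w2 by rewrite ltr_wpDr// subr_gt0.
suff H n : along k x n @ \oo --> (0 : R) /\ along k y n @ \oo --> (0 : R).
  split; under eq_cvg do rewrite subr0.
    by apply: along_cvg0 k_gt0 _ => n; case: (H n).
  by apply: along_cvg0 k_gt0 _ => n; case: (H n).
pose s i := w1 * along k x n i + w2 * along k y n i.
have sS : \forall i \near \oo,
    Delta * (along k x n i + along k y n i) <= s i - s i.+1.
  apply: filterS (near_along_solution n) => i [x0 y0 hx hy].
  have := ler_wpM2l (ltW w10) hx; have := ler_wpM2l (ltW w20) hy.
  by rewrite /s /w1 /w2 /Delta; lra.
have cs : cvgn s.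
  apply: near_nonincreasing_ge0_cvgn.
    apply: filterS (near_along_solution n) => i [x0 y0 _ _].
    by rewrite addr_ge0// mulr_ge0// ltW.
  apply: filterS2 sS (near_along_solution n) => i si [x0 y0 _ _].
  rewrite -subr_ge0 (le_trans _ si)//.
  exact: mulr_ge0 (ltW Delta_gt0) (addr_ge0 x0 y0).
have ds : (fun i => Delta^-1 * (s i - s i.+1)) @ \oo --> (0 : R).
  by rewrite -(mulr0 Delta^-1); apply: cvgMr; exact: cvgn_diffS0.
split; apply: (squeeze_cvgr _ (cvg_cst 0) ds);
  apply: filterS2 sS (near_along_solution n) => i si [x0 y0 _ _].
- by rewrite x0/= ler_pdivlMl// (le_trans _ si)// ler_wpM2l ?lerDl// ltW.
- by rewrite y0/= ler_pdivlMl// (le_trans _ si)// ler_wpM2l ?lerDr// ltW.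
Qed.

Lemma solution_nonincreasing_cvgn (p : nat) : (0 < p)%N ->
  (forall m : int, 1 <= m -> x (m + p%:Z) <= x m) ->
  forall n, cvgn (along p x n).
Proof.
move=> p0 xp n; apply: near_nonincreasing_ge0_cvgn;
  apply: filterS (near_along_ge n 1 p0) => i n1.
  by apply: (solution_ge0 _).1; rewrite /first_index; lia.
by rewrite alongS addrAC; exact: xp.
Qed.

(** [A] exchanges the coordinates up to the factors [gamma] and [delta], so two steps multiply the
    bound on [x] by [gamma * delta = 1]. *)
Lemma solution_cvgn_swapping : beta = 0 -> eps = 0 -> gamma * delta = 1 ->
  forall n, cvgn (along (2 * k) x n).
Proof.
move=> beta0 eps0 gd1; apply: solution_nonincreasing_cvgn => [|m m1]; first lia.
have [hx _] := @solution_le (m + (2 * k)%N%:Z) ltac:(lia).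
have [_ hy] := @solution_le (m + k%:Z) ltac:(lia).
move: hx hy; rewrite beta0 eps0 !mul0r add0r addr0 addrK.
rewrite (_ : m + _ - _ = m + k%:Z); last lia.
move=> hx hy; rewrite (le_trans hx)// (le_trans (ler_wpM2l gamma_ge0 hy))//.
by rewrite mulrA gd1 mul1r.
Qed.

(** Only the first row of [A] is that of the identity, so this also covers the triangular case in
    which [x] drives [y]. *)
Lemma solution_cvgn_identity : beta = 1 -> gamma = 0 ->
  forall n, cvgn (along k x n).
Proof.
move=> beta1 gamma0; apply: solution_nonincreasing_cvgn => // m m1.
have [+ _] := @solution_le (m + k%:Z) ltac:(lia).
by rewrite beta1 gamma0 mul1r mul0r addr0 addrK.
Qed.

(* [w1 x + w2 y] decreases along each residue class, so its decrements, which
   bound the defects of the linear recursion, tend to 0; eliminating [y] leaves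
   an affine recursion for [x] whose ratio is the other eigenvalue of [A]. *)
Lemma solution_cvgn_left_eigenvector (w1 w2 : R) : 0 < w1 -> 0 < w2 ->
  w1 * beta + w2 * delta = w1 -> w1 * gamma + w2 * eps = w2 ->
  `|beta + eps - 1| < 1 -> forall n, cvgn (along k x n).
Proof.
move=> w10 w20 wA1 wA2 q1 n.
pose s i := w1 * along k x n i + w2 * along k y n i.
pose e i := beta * along k x n i + gamma * along k y n i - along k x n i.+1.
(* Since [w A = w], the decrement of [s] is [w1] times the defect [e] of [x] plus [w2] times that of
   [y], both nonnegative. *)
have sS : \forall i \near \oo, 0 <= w1 * e i <= s i - s i.+1.
  apply: filterS (near_along_solution n) => i [x0 y0 hx hy].
  rewrite (mulr_ge0 (ltW w10)) ?subr_ge0//= /s /e.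
  have := ler_wpM2l (ltW w20) hy.
  have := congr1 ( *%R^~ (along k x n i)) wA1.
  have := congr1 ( *%R^~ (along k y n i)) wA2.
  by move=> /= e1 e2 e3; lra.
have cs : cvgn s.
  apply: near_nonincreasing_ge0_cvgn.
    apply: filterS (near_along_solution n) => i [x0 y0 _ _].
    by rewrite addr_ge0// mulr_ge0// ltW.
  by apply: filterS sS => i /andP[h1 h2]; rewrite -subr_ge0 (le_trans h1).
have ce : e @ \oo --> (0 : R).
  have ds : (fun i => w1^-1 * (s i - s i.+1)) @ \oo --> (0 : R).
    by rewrite -(mulr0 w1^-1); apply: cvgMr; exact: cvgn_diffS0.
  apply: (squeeze_cvgr _ (cvg_cst 0) ds); apply: filterS sS => i /andP[h1 h2].
  by rewrite -(pmulr_rge0 _ w10) h1/= ler_pdivlMl.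
(* Substituting [y = (s - w1 x) / w2] gives the ratio [beta - gamma * w1 / w2], which [wA2] turns
   into [beta + eps - 1]. *)
apply: (@affine_recurrence_cvg _ (beta + eps - 1) _
  (fun i => gamma / w2 * s i - e i)) => //.
  apply: is_cvgB; first by apply: is_cvgMr.
  by apply/cvg_ex; exists 0.
apply: nearW => i; rewrite /s /e.
have w2_neq0 : w2 != 0 by rewrite gt_eqF.
have -> : eps = (w2 - w1 * gamma) / w2.
  by apply: (canRL (mulfK w2_neq0)); lra.
by field.
Qed.

Lemma near_along_forced_bounded (n : int) : beta = 1 -> gamma = 0 -> eps < 1 ->
  has_lbound (range (along k y n)) /\ has_ubound (range (along k y n)).
Proof.
move=> beta1 gamma0 eps1; set K := limn (along k x n) + 1.
have cx : along k x n @ \oo --> limn (along k x n).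
  exact: solution_cvgn_identity.
have [N _ HN] : \forall i \near \oo, along k x n i <= K /\
    [/\ 0 <= along k x n i, 0 <= along k y n i,
      along k x n i.+1 <= beta * along k x n i + gamma * along k y n i &
      along k y n i.+1 <= delta * along k x n i + eps * along k y n i].
  apply: filterI (near_along_solution n).
  by apply: (cvgr_le _ cx); rewrite /K ltrDl.
(* [delta * K / (1 - eps)] is the fixed point of [t |-> delta * K + eps * t]; above it, a bound [b]
   on [y] propagates to the next step. *)
pose b := Num.max (along k y n N) (delta * K / (1 - eps)).
have bN : along k y n N <= b by rewrite le_max lexx.
have bK : delta * K <= b * (1 - eps).
  by rewrite -ler_pdivrMr ?subr_gt0// le_max lexx orbT.
apply: (@near_bounded_range _ _ 0 b); exists N => // i /= /subnK <-.
elim: (i - N)%N => [|j IH].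
  by rewrite add0n bN; have [_ [_ ->]] := HN N (leqnn _).
have [_ [_ y0 _ _]] := HN (j.+1 + N)%N (leq_addl _ _); rewrite y0/=.
have [xK [_ _ _]] := HN (j + N)%N (leq_addl _ _).
rewrite -addSn => /le_trans; apply.
rewrite (@le_trans _ _ (delta * K + eps * b))//; last by lra.
by rewrite lerD// ler_wpM2l//; case/andP: IH.
Qed.

(* The upper and lower limits [M], [m] of [y] along the residue classes satisfy
   [M n * den(x', m) <= delta * x' n + eps * M n] and the reverse inequality with
   [m] and [M] exchanged, which forces [m = M]. *)
Lemma solution_cvgn_forced : beta = 1 -> gamma = 0 -> eps < 1 ->
  forall n, cvgn (along k y n).
Proof.
move=> beta1 gamma0 eps1.
have cx n : along k x n @ \oo --> limn (along k x n).
  exact: solution_cvgn_identity.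
have bx n : has_lbound (range (along k x n)) /\ has_ubound (range (along k x n)).
  have bf := cvg_seq_bounded (cx n).
  by split; [exact: bounded_fun_has_lbound|exact: bounded_fun_has_ubound].
have by_ n := near_along_forced_bounded n beta1 gamma0 eps1.
pose x' n := limn (along k x n).
pose M n := limn (sups (along k y n)); pose m n := limn (infs (along k y n)).
have cS n : sups (along k y n) @ \oo --> M n.
  have [bl bu] := by_ n; apply/cvg_ex.
  by exists (inf (range (sups (along k y n)))); exact: cvg_sups_inf.
have cI n : infs (along k y n) @ \oo --> m n.
  have [bl bu] := by_ n; apply/cvg_ex.
  by exists (sup (range (infs (along k y n)))); exact: cvg_infs_sup.
have x'k n : x' (n + k%:Z) = x' n.
  by apply/cvg_lim => //; rewrite along_addp (cvg_shiftS (along k x n)).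
have supsS (u : R^nat) : sups (fun i => u i.+1) = fun i => sups u i.+1.
  apply/funext => i; rewrite /sups /=; congr (sup _); apply/seteqP; split=> _ [j /= ij <-].
    by exists j.+1.
  by exists j.-1; rewrite ?prednK//; case: j ij.
have infsS (u : R^nat) : infs (fun i => u i.+1) = fun i => infs u i.+1.
  apply/funext => i; rewrite /infs /=; congr (inf _); apply/seteqP; split=> _ [j /= ij <-].
    by exists j.+1.
  by exists j.-1; rewrite ?prednK//; case: j ij.
have Mk n : M (n + k%:Z) = M n.
  apply/cvg_lim => //; rewrite along_addp supsS.
  by rewrite (cvg_shiftS (sups (along k y n))).
have mk n : m (n + k%:Z) = m n.
  apply/cvg_lim => //; rewrite along_addp infsS.
  by rewrite (cvg_shiftS (infs (along k y n))).
have x'0 n : 0 <= x' n.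
  apply: limr_ge; first exact: cx.
  by apply: filterS (near_along_solution n) => i [].
have m0 n : 0 <= m n.
  apply: limr_ge; first by apply/cvg_ex; exists (m n); exact: cI.
  apply: filterS (near_all_ge (near_along_solution n)) => i ij.
  by apply: infs_ge => j /ij[].
have mM n : m n <= M n.
  apply: ler_cvg_to (cI n) (cS n) _; apply: nearW => i.
  exact: le_trans (infs_le (by_ n).1 (leqnn i)) (sups_ge (by_ n).2 (leqnn i)).
have k_shift (f : int -> R) n :
    (forall n, f (n + k%:Z) = f n) -> f (n - k%:Z) = f n.
  by move=> fk; rewrite -[in RHS](subrK k%:Z n) fk.
have yE n j : 1 <= n + (j * k)%N%:Z -> along k y n j =
    (delta * along k x (n - k%:Z) j + eps * along k y (n - k%:Z) j) /
    den D E ((along k x)^~ j) ((along k y)^~ j) n.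
  by move=> n1; rewrite -along_den /along (sol.2 _ n1).2 [n - _ + _]addrAC.
have later n i j : (i <= j)%N -> 1 <= n + (i * k)%N%:Z ->
    1 <= n + (j * k)%N%:Z.
  by move=> ij; have : (i * k <= j * k)%N by [rewrite leq_mul2r ij orbT]; lia.
have ge0 n a j : (a <= maxn k l)%N -> 1 <= n + (j * k)%N%:Z ->
    0 <= along k x (n - a%:Z) j /\ 0 <= along k y (n - a%:Z) j.
  by move=> al n1; rewrite /along [n - _ + _]addrAC; exact: solution_prev_ge0.
(* Tail suprema and infima from stage [i] on: they enclose every later stage and converge as [i]
   grows. *)
pose sx i a := sups (along k x a) i; pose ix i a := infs (along k x a) i.
pose sy i a := sups (along k y a) i; pose iy i a := infs (along k y a) i.
have cden_i n : den D E (ix i) (iy i) n @[i --> \oo] --> den D E x' m n.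
  by apply: den_cvg => a; [exact: cvg_infs|exact: cI].
have cden_s n : den D E (sx i) (sy i) n @[i --> \oo] --> den D E x' M n.
  by apply: den_cvg => a; [exact: cvg_sups|exact: cS].
(* Every stage [j >= i] of [y] is at most the numerator at the tail suprema over the denominator at
   the tail infima; take the supremum over [j], then let [i] grow. Periodicity absorbs the lag
   [k]. *)
have upper n : M n * den D E x' m n <= delta * x' n + eps * M n.
  rewrite -[in leRHS](k_shift x')// -[in leRHS](k_shift M)//.
  have cl : sy i n * den D E (ix i) (iy i) n @[i --> \oo] -->
      M n * den D E x' m n by apply: cvgM; [exact: cS|exact: cden_i].
  have cr : delta * sx i (n - k%:Z) + eps * sy i (n - k%:Z) @[i --> \oo] -->
      delta * x' (n - k%:Z) + eps * M (n - k%:Z).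
    by apply: cvgD; apply: cvgMr; [exact: cvg_sups|exact: cS].
  apply: ler_cvg_to cl cr _.
  apply: filterS (near_along_ge n 1 k_gt0) => i n1.
  have d1 : 1 <= den D E (ix i) (iy i) n.
    apply: den_ge1 => j jl; first exact: DE_ge0.
    by split; apply: infs_ge => a ia;
      have [|? ?] := ge0 n j a _ (later _ _ _ ia n1) => //; lia.
  have d0 := lt_le_trans ltr01 d1.
  rewrite -ler_pdivlMr//; apply: sups_le => j ij.
  have [x0 y0] := ge0 n k j (leq_maxl _ _) (later _ _ _ ij n1).
  have dle : den D E (ix i) (iy i) n <=
      den D E ((along k x)^~ j) ((along k y)^~ j) n.
    by apply: le_den => [|a _|a _]; [exact: DE_ge0|
      exact: infs_le (bx _).1 ij|exact: infs_le (by_ _).1 ij].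
  rewrite (yE _ _ (later _ _ _ ij n1)); apply: ler_pM.
  - by rewrite addr_ge0// mulr_ge0.
  - by rewrite invr_ge0 (le_trans _ dle)// ltW.
  - by apply: lerD; apply: ler_wpM2l => //;
      [exact: sups_ge (bx _).2 ij|exact: sups_ge (by_ _).2 ij].
  - by rewrite lef_pV2// posrE (lt_le_trans d0).
have lower n : delta * x' n + eps * m n <= m n * den D E x' M n.
  rewrite -[in leLHS](k_shift x')// -[in leLHS](k_shift m)//.
  have cl : iy i n * den D E (sx i) (sy i) n @[i --> \oo] -->
      m n * den D E x' M n by apply: cvgM; [exact: cI|exact: cden_s].
  have cr : delta * ix i (n - k%:Z) + eps * iy i (n - k%:Z) @[i --> \oo] -->
      delta * x' (n - k%:Z) + eps * m (n - k%:Z).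
    by apply: cvgD; apply: cvgMr; [exact: cvg_infs|exact: cI].
  apply: ler_cvg_to cr cl _.
  apply: filterS (near_along_ge n 1 k_gt0) => i n1.
  have dle j : (i <= j)%N -> den D E ((along k x)^~ j) ((along k y)^~ j) n <=
      den D E (sx i) (sy i) n.
    move=> ij; apply: le_den => [|a _|a _]; [exact: DE_ge0|
      exact: sups_ge (bx _).2 ij|exact: sups_ge (by_ _).2 ij].
  have d1 j : (i <= j)%N -> 1 <= den D E ((along k x)^~ j) ((along k y)^~ j) n.
    move=> ij; apply: den_ge1 => a al; first exact: DE_ge0.
    by apply: ge0 (later _ _ _ ij n1); lia.
  have d0 : 0 < den D E (sx i) (sy i) n.
    exact: lt_le_trans ltr01 (le_trans (d1 i (leqnn i)) (dle i (leqnn i))).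
  rewrite -ler_pdivrMr//; apply: infs_ge => j ij.
  rewrite (yE _ _ (later _ _ _ ij n1)); apply: ler_pM.
  - have [x0 y0] : 0 <= ix i (n - k%:Z) /\ 0 <= iy i (n - k%:Z).
      by split; apply: infs_ge => a ia;
        have [] := ge0 n k a (leq_maxl _ _) (later _ _ _ ia n1).
    by rewrite addr_ge0// mulr_ge0.
  - by rewrite invr_ge0 ltW.
  - by apply: lerD; apply: ler_wpM2l => //;
      [exact: infs_le (bx _).1 ij|exact: infs_le (by_ _).1 ij].
  - rewrite lef_pV2 ?posrE//; first exact: dle.
    exact: lt_le_trans ltr01 (d1 j ij).
have mM_eq : forall n, m n = M n.
  (* Moving the [eps] term to the denominator side gives the form of [envelope_collapse]; [eps < 1]
     keeps [Q] positive. *)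
  pose Q n := 1 - eps + \sum_(1 <= j < l.+1) D j * x' (n - j%:Z).
  apply: (@envelope_collapse (fun n => delta * x' n) Q) => // n.
  - by rewrite m0 mM.
  - rewrite ltr_wpDr ?subr_gt0// big_nat sumr_ge0// => j jl.
    by rewrite mulr_ge0//; case: (DE_ge0 jl).
  - by have := upper n; rewrite /den /Q; lra.
  - by have := lower n; rewrite /den /Q; lra.
move=> n; apply/cvg_ex; exists (M n).
have := cI n; rewrite mM_eq => cI'; apply: squeeze_cvgr cI' (cS n).
apply: nearW => i.
by rewrite (infs_le (by_ n).1 (leqnn i)) (sups_ge (by_ n).2 (leqnn i)).
Qed.

End one_solution.
End solutions.

(** * Convergence when 1 is a semisimple eigenvalue and -1 is not an eigenvalue *)

Section power_bounded_convergence.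
Variables (R : realType) (k l : nat) (beta gamma delta eps : R).
Variables (B C D E : nat -> R).
Hypotheses (k_gt0 : (0 < k)%N).
Hypotheses (beta_ge0 : 0 <= beta) (gamma_ge0 : 0 <= gamma).
Hypotheses (delta_ge0 : 0 <= delta) (eps_ge0 : 0 <= eps).
Hypothesis BCDE_ge0 : forall j : nat, (1 <= j <= l)%N ->
  [/\ 0 <= B j, 0 <= C j, 0 <= D j & 0 <= E j].

(** The hypotheses say that 1 is an eigenvalue, that the other one, [beta + eps - 1], exceeds -1,
    and that it equals 1 only for the identity. Apart from the identity, a positive left eigenvector
    is missing only when a row of [A] is that of the identity, which is the forced case. *)
Lemma solution_cvgn_power_bounded (x y : int -> R) :
  (1 - beta) * (1 - eps) = gamma * delta -> beta <= 1 -> eps <= 1 ->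
  0 < beta + eps -> (beta + eps = 2 -> gamma = 0 /\ delta = 0) ->
  is_solution k l beta gamma delta eps B C D E x y ->
  forall n, cvgn (along k x n) /\ cvgn (along k y n).
Proof.
move=> det1 beta1 eps1 tr_gt0 tr2 sol n.
have sol' := is_solution_swap sol.
have EDCB_ge0 j : (1 <= j <= l)%N ->
    [/\ 0 <= E j, 0 <= D j, 0 <= C j & 0 <= B j] by case/BCDE_ge0.
have b0 := beta_ge0; have g0 := gamma_ge0.
have d0 := delta_ge0; have e0 := eps_ge0.
have [tr_eq2|tr_neq2] := eqVneq (beta + eps) 2.
  have [gamma0 delta0] := tr2 tr_eq2.
  split.
    by apply: (solution_cvgn_identity _ _ _ _ _ _ sol) => //; lra.
  by apply: (solution_cvgn_identity _ _ _ _ _ _ sol') => //; lra.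
have q1 : `|beta + eps - 1| < 1.
  have : beta + eps < 2 by rewrite lt_neqAle tr_neq2; lra.
  by rewrite ltr_norml => ?; apply/andP; split; lra.
have q1' : `|eps + beta - 1| < 1 by rewrite [eps + _]addrC.
have left_vector w1 w2 : 0 < w1 -> 0 < w2 ->
    w1 * beta + w2 * delta = w1 -> w1 * gamma + w2 * eps = w2 ->
    cvgn (along k x n) /\ cvgn (along k y n).
  move=> w10 w20 wA1 wA2; split.
    exact: (solution_cvgn_left_eigenvector _ _ _ _ _ _ sol w10 w20).
  by apply: (solution_cvgn_left_eigenvector _ _ _ _ _ _ sol' w20 w10) => //;
    rewrite addrC.
have [beta_eq1|beta_neq1] := eqVneq beta 1.
  have gd0 : gamma * delta = 0 by rewrite -det1 beta_eq1 subrr mul0r.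
  have eps_lt1 : eps < 1 by lra.
  have [gamma0|gamma_neq0] := eqVneq gamma 0.
    split; first exact: (solution_cvgn_identity _ _ _ _ _ _ sol).
    exact: (solution_cvgn_forced _ _ _ _ _ _ sol).
  have gamma_gt0 : 0 < gamma by rewrite lt0r gamma_neq0.
  (* This vector solves the second column of [w (I - A) = 0]; the first follows from the vanishing
     determinant. *)
  by apply: (left_vector (1 - eps) gamma) => //; rewrite ?gd0 ?beta_eq1; lra.
have beta_lt1 : beta < 1 by rewrite lt_neqAle beta_neq1.
have [delta_eq0|delta_neq0] := eqVneq delta 0.
  have eps_eq1 : eps = 1.
    have /eqP := det1; rewrite delta_eq0 mulr0 mulf_eq0 !subr_eq0.
    by rewrite [1 == beta]eq_sym (negPf beta_neq1) => /eqP.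
  split; first exact: (solution_cvgn_forced _ _ _ _ _ _ sol').
  exact: (solution_cvgn_identity _ _ _ _ _ _ sol').
have delta_gt0 : 0 < delta by rewrite lt0r delta_neq0.
(* Here the first column is solved, and the second follows. *)
by apply: (left_vector delta (1 - beta)) => //; lra.
Qed.

End power_bounded_convergence.

(** * Solutions supported on the multiples of [k] *)

Section solutions_on_multiples.
Variables (R : realType) (k l : nat) (beta gamma delta eps : R).
Variables (B C D E : nat -> R).
Hypothesis k_gt0 : (0 < k)%N.
Hypothesis BCDE_eq0 : forall j : nat, (1 <= j <= l)%N -> (k %| j)%N ->
  [/\ B j = 0, C j = 0, D j = 0 & E j = 0].

Definition spread (f : int -> R) (n : int) : R :=
  if (k%:Z %| n)%Z then f (n %/ k%:Z)%Z else 0.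

Lemma spread_mul (f : int -> R) (m : int) : spread f (m * k%:Z) = f m.
Proof. by rewrite /spread dvdz_mull ?mulzK// -lt0n. Qed.

Lemma spread_ndvd (f : int -> R) (n : int) :
  ~~ (k%:Z %| n)%Z -> spread f n = 0.
Proof. by rewrite /spread => /negPf ->. Qed.

(** Lags divisible by [k] have zero coefficients, and any other lag leads from a multiple of [k] to
    an index where [spread] vanishes. *)
Lemma spread_den (P Q : nat -> R) (f g : int -> R) (m : int) :
  (forall j : nat, (1 <= j <= l)%N -> (k %| j)%N -> P j = 0 /\ Q j = 0) ->
  den l P Q (spread f) (spread g) (m * k%:Z) = 1.
Proof.
move=> PQ; have z (S : nat -> R) (h : int -> R) :
    (forall j : nat, (1 <= j <= l)%N -> (k %| j)%N -> S j = 0) ->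
    \sum_(1 <= j < l.+1) S j * spread h (m * k%:Z - j%:Z) = 0.
  move=> S0; rewrite big_nat big1// => j jl.
  have [kj|kj] := boolP (k %| j)%N; first by rewrite S0// mul0r.
  by rewrite spread_ndvd ?mulr0// rpredBl ?dvdz_mull.
by rewrite /den !z ?addr0// => j jl /(PQ j jl)[].
Qed.

Lemma spread_solution (f g : int -> R) :
  (forall m : int, m <= 0 -> 0 <= f m /\ 0 <= g m) ->
  (forall m : int, 0 <= m -> f (m + 1) = beta * f m + gamma * g m /\
                             g (m + 1) = delta * f m + eps * g m) ->
  is_solution k l beta gamma delta eps B C D E (spread f) (spread g).
Proof.
move=> fg0 fgS; split=> n hn.
  rewrite /spread; case: ifP => // kn; apply: fg0.
  by rewrite lez_divLR// ?mul0r//; case/andP: hn.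
rewrite -![1 + _ + _]/(den _ _ _ _ _ _).
have [/dvdzP[m nE]|kn] := boolP (k%:Z %| n)%Z; last first.
  have kn' : ~~ (k%:Z %| n - k%:Z)%Z by rewrite rpredBr.
  by rewrite !(spread_ndvd _ kn) !(spread_ndvd _ kn') !mulr0 addr0 !mul0r.
have m1 : 1 <= m by move: hn; rewrite nE; nia.
rewrite nE !spread_den ?divr1; last 2 first.
- by move=> j jl /(BCDE_eq0 jl)[].
- by move=> j jl /(BCDE_eq0 jl)[].
have -> : m * k%:Z - k%:Z = (m - 1) * k%:Z by rewrite mulrBl mul1r.
have [] := fgS (m - 1); first by lia.
by rewrite subrK !spread_mul => -> ->.
Qed.

End solutions_on_multiples.

(** Bernoulli's inequality without its constant term, in the linear form that [spread_unbounded]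
    asks for. *)
Lemma le_expr_bernoulli (R : realDomainType) (r : R) (m : nat) :
  1 <= r -> (r - 1) * m%:R <= r ^+ m.
Proof.
move=> r1; elim: m => [|m IH]; first by rewrite mulr0 expr0.
rewrite -natr1 mulrDr mulr1 exprS -[X in _ <= X * _](subrK 1 r).
rewrite [leRHS]mulrDl mul1r [leRHS]addrC.
by rewrite lerD// ler_peMr ?subr_ge0// exprn_ege1.
Qed.

Lemma dvdz2_addr1 (m : int) : (2 %| m + 1)%Z = ~~ (2 %| m)%Z.
Proof. by lia. Qed.

Lemma absz_addr1 (m : int) : 0 <= m -> absz (m + 1) = (absz m).+1.
Proof. by lia. Qed.

(** * Prime periods and growth of these solutions *)

Section solutions_on_multiples_behavior.
Variables (R : realType) (k l : nat).
Hypothesis k_gt0 : (0 < k)%N.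

Lemma spread_addk (f : int -> R) (n : int) :
  spread k f (n + k%:Z) = spread k (fun m => f (m + 1)) n.
Proof.
rewrite /spread rpredDr ?dvdzz//; case: ifP => // /dvdzP[m ->].
by rewrite -[X in _ + X]mul1r -mulrDl !mulzK// -lt0n.
Qed.

(** A period [q] carries the nonzero pair at index 0 to index [q], which must therefore lie in the
    support. *)
Lemma spread_period_dvd (f g : int -> R) (q : nat) : 0 < f 0 + g 0 ->
  has_period k l q (spread k f) (spread k g) -> (k %| q)%N.
Proof.
move=> fg0 /(_ 0); rewrite add0r => -[]; first by rewrite /first_index; lia.
have s0 (h : int -> R) : spread k h 0 = h 0 by rewrite -(mul0r k%:Z) spread_mul.
rewrite !s0; have [//|kq] := boolP (k %| q)%N.
rewrite !spread_ndvd// => f0 g0.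
by move: fg0; rewrite -f0 -g0 addr0 ltxx.
Qed.

Lemma spread_prime_period (v w : R) : 0 < v + w ->
  has_prime_period k l k (spread k (fun=> v)) (spread k (fun=> w)).
Proof.
move=> vw; split=> // [n _|q q0 /(spread_period_dvd vw)]; last exact: dvdn_leq.
by rewrite !spread_addk.
Qed.

(** Periods are multiples of [k], and [k] itself would equate the value [v] at index 0 with the
    value 0 at index [k]. *)
Lemma spread_alternating_prime_period (v w : R) : 0 < v ->
  has_prime_period k l (2 * k)
    (spread k (fun m => if (2 %| m)%Z then v else 0))
    (spread k (fun m => if (2 %| m)%Z then 0 else w)).
Proof.
move=> v0; split=> [|n _|q q0 per]; first lia.
  rewrite mul2n -addnn PoszD addrA !spread_addk.
  by split; congr (spread k _ n); apply/funext => m;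
    rewrite -addrA (_ : 1 + 1 = 2)// rpredDr.
have /dvdnP[a qE] : (k %| q)%N.
  by apply: spread_period_dvd per; rewrite dvdz0 addr0.
rewrite qE leq_mul2r; apply/orP; right.
case: a qE => [|[|a]]// qE; first by move: q0; rewrite qE mul0n.
have := per 0; rewrite qE mul1n add0r => -[].
  by rewrite /first_index; lia.
rewrite -(mul0r k%:Z) -[in X in X = _](mul1r k%:Z) !spread_mul// dvdz0.
by move=> /= v0'; move: v0; rewrite -v0' ltxx.
Qed.

Lemma spread_unbounded (f g : int -> R) (c : R) : 0 < c ->
  (forall m : nat, c * m%:R <= f m%:Z + g m%:Z) ->
  unbounded_sum k l (spread k f) (spread k g).
Proof.
move=> c0 fgc [M [_ HM]].
pose m := Num.bound `|(M + 1) / c|.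
have Mm : (M + 1) / c < m%:R.
  exact: le_lt_trans (ler_norm _) (archi_boundP (normr_ge0 _)).
have M1 : M < M + 1 by rewrite ltrDl.
have : f m%:Z + g m%:Z <= M + 1.
  apply: le_trans (ler_norm _) _; apply: (HM _ M1).
  by exists (m%:Z * k%:Z); rewrite ?spread_mul//= /first_index; lia.
apply/negP; rewrite -ltNge (lt_le_trans _ (fgc m))//.
by rewrite mulrC -ltr_pdivrMr.
Qed.

End solutions_on_multiples_behavior.

(** * Spectrum of a nonnegative 2 by 2 matrix *)

Section two_by_two_spectrum.
Variables (R : realType) (beta gamma delta eps : R).
Hypotheses (beta_ge0 : 0 <= beta) (gamma_ge0 : 0 <= gamma).
Hypotheses (delta_ge0 : 0 <= delta) (eps_ge0 : 0 <= eps).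

(** The discriminant [d] is at least [(beta - eps) ^+ 2], so the roots are real and the larger one
    dominates both diagonal entries; the nonnegative trace gives [|r2| <= r1]. *)
Lemma mx22_eigenvalues_ex : exists r1 r2 : R,
  [/\ r1 + r2 = beta + eps, r1 * r2 = beta * eps - gamma * delta,
      `|r2| <= r1, beta <= r1 & eps <= r1].
Proof.
pose d := (beta - eps) ^+ 2 + 4 * gamma * delta.
have d_ge : (beta - eps) ^+ 2 <= d by rewrite lerDl mulr_ge0// mulr_ge0.
have d0 : 0 <= d by rewrite (le_trans (sqr_ge0 _) d_ge).
have s0 := sqrtr_ge0 d; have b0 := beta_ge0; have e0 := eps_ge0.
have be : `|beta - eps| <= Num.sqrt d by rewrite -sqrtr_sqr ler_wsqrtr.
have := be; rewrite ler_norml => /andP[be1 be2].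
exists ((beta + eps + Num.sqrt d) / 2), ((beta + eps - Num.sqrt d) / 2).
split; [lra| |rewrite ler_norml; apply/andP; split; lra|lra|lra].
have := sqr_sqrtr d0; rewrite expr2 => sd.
rewrite (_ : _ * _ = ((beta + eps) ^+ 2 - Num.sqrt d * Num.sqrt d) / 4); last by field.
by rewrite sd /d; field.
Qed.

(** By Cayley-Hamilton, [A - r1 I] kills the columns of [A - r2 I]. Their sum is the nonnegative
    vector used; it vanishes only if [A = r1 I], and then [(1, 0)] serves. *)
Lemma perron_vector (r1 r2 : R) : r1 + r2 = beta + eps ->
  r1 * r2 = beta * eps - gamma * delta -> beta <= r1 -> eps <= r1 ->
  exists v1 v2 : R, [/\ 0 <= v1, 0 <= v2, 0 < v1 + v2,
    beta * v1 + gamma * v2 = r1 * v1 & delta * v1 + eps * v2 = r1 * v2].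
Proof.
move=> tr dt b1 e1.
have r2E : r2 = beta + eps - r1 by lra.
have {}dt : r1 * (beta + eps - r1) = beta * eps - gamma * delta by rewrite -r2E.
have g_ge0 := gamma_ge0; have d_ge0 := delta_ge0.
have v10 : 0 <= gamma + r1 - eps by lra.
have v20 : 0 <= r1 - beta + delta by lra.
have [v0|v0] := ltP 0 (gamma + r1 - eps + (r1 - beta + delta)).
  by exists (gamma + r1 - eps), (r1 - beta + delta); split=> //; lra.
exists 1, 0; have [g0 d0] : gamma = 0 /\ delta = 0.
  by split; apply/eqP; rewrite eq_le; apply/andP; split; lra.
by split; rewrite ?ler01// ?g0 ?d0; lra.
Qed.

Local Notation A := (mx22 beta gamma delta eps).

Lemma Re_norm_real_complex (a : R) : complex.Re `|a%:C| = `|a|.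
Proof. by rewrite normc_def/= expr0n addr0 sqrtr_sqr. Qed.

Lemma char_poly_complexify (r1 r2 : R) : r1 + r2 = beta + eps ->
  r1 * r2 = beta * eps - gamma * delta ->
  char_poly (complexify A) = ('X - (r1%:C)%:P) * ('X - (r2%:C)%:P).
Proof.
move=> tr dt; rewrite -map_char_poly.
have -> : char_poly A = ('X - r1%:P) * ('X - r2%:P).
  rewrite /char_poly (expand_det_row _ ord0) !big_ord_recl big_ord0.
  rewrite /cofactor !det_mx11 !mxE /=.
  have -> : ('X - r1%:P) * ('X - r2%:P) = 'X * 'X - (r1 + r2)%:P * 'X + (r1 * r2)%:P.
    by rewrite polyCD polyCM; ring.
  rewrite tr dt polyCB polyCD !polyCM.
  by rewrite /bump /= ; ring.
by rewrite rmorphM !rmorphB/= !map_polyX !map_polyC.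
Qed.

Lemma eigenvalue_complexify (r1 r2 : R) (lam : R[i]) : r1 + r2 = beta + eps ->
  r1 * r2 = beta * eps - gamma * delta ->
  eigenvalue (complexify A) lam = (lam == r1%:C) || (lam == r2%:C).
Proof.
move=> tr dt; rewrite eigenvalue_root_char (char_poly_complexify tr dt).
by rewrite rootM !root_XsubC.
Qed.

Lemma alg_mult_complexify (r1 r2 : R) (lam : R[i]) : r1 + r2 = beta + eps ->
  r1 * r2 = beta * eps - gamma * delta ->
  alg_mult A lam = ((r1%:C == lam) + (r2%:C == lam))%N.
Proof.
move=> tr dt; rewrite /alg_mult (char_poly_complexify tr dt).
rewrite mupM ?polyXsubC_eq0// -['X - (r1%:C)%:P]expr1 -['X - (r2%:C)%:P]expr1.
by rewrite !mup_XsubCX; do 2!case: eqP.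
Qed.

Lemma spectral_radius_mx22 (r1 r2 : R) : r1 + r2 = beta + eps ->
  r1 * r2 = beta * eps - gamma * delta -> `|r2| <= r1 ->
  spectral_radius A = r1.
Proof.
move=> tr dt r21; have r10 : 0 <= r1 := le_trans (normr_ge0 _) r21.
rewrite /spectral_radius; set S := (X in sup X).
have Sub z : S z -> z <= r1.
  move=> [lam]; rewrite /= (eigenvalue_complexify _ tr dt).
  by case/orP => /eqP -> <-; rewrite [leLHS]Re_norm_real_complex// ger0_norm.
have Sr1 : S r1.
  exists r1%:C; first by rewrite /= (eigenvalue_complexify _ tr dt) eqxx.
  by rewrite [LHS]Re_norm_real_complex ger0_norm.
apply/eqP; rewrite eq_le; apply/andP; split.
  by apply: ge_sup; [exists r1|move=> z; exact: Sub].
by apply: ub_le_sup => //; exists r1 => z; exact: Sub.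
Qed.

Lemma geom_mult_full (lam : R) : (2 <= geom_mult A lam%:C)%N ->
  [/\ beta = lam, gamma = 0, delta = 0 & eps = lam].
Proof.
rewrite /geom_mult mxrank_ker; set G := _ - _ => G2.
have /eqP G0 : G == 0 by rewrite -mxrank_eq0; move: (\rank G) G2; clear; lia.
have H i j : (A j i)%:C - lam%:C *+ (i == j) = 0.
  by have := congr1 (fun M : 'M[R[i]]_2 => M i j) G0; rewrite /G !mxE.
have := (H 0 0, H 1 0, H 0 1, H 1 1); rewrite !mxE/= !mulr1n !mulr0n !subr0.
by case=> [[[/subr0_eq/complexI -> /complexI ->] /complexI ->] /subr0_eq/complexI ->].
Qed.

Lemma geom_mult_scalar (lam : R) : geom_mult (mx22 lam 0 0 lam) lam%:C = 2.
Proof.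
rewrite /geom_mult mxrank_ker (_ : _ - _ = 0) ?mxrank0//.
apply/matrixP => i j; rewrite !mxE.
by case: i j => [[|[|//]] ?] [[|[|//]] ?]/=; rewrite ?subrr ?subr0.
Qed.

(** [eigenvalue] concerns row eigenvectors and [geom_mult] column ones; transposition preserves the
    characteristic polynomial. *)
Lemma geom_mult_gt0 (lam : R[i]) :
  eigenvalue (complexify A) lam -> (0 < geom_mult A lam)%N.
Proof.
have char_tr : char_poly (complexify A)^T = char_poly (complexify A).
  rewrite /char_poly -[in RHS]det_tr; congr (\det _).
  by rewrite /char_poly_mx linearB/= tr_scalar_mx [in RHS]map_trmx.
rewrite /geom_mult lt0n mxrank_eq0 eigenvalue_root_char -char_tr.
by rewrite -eigenvalue_root_char.
Qed.

End two_by_two_spectrum.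

(** * The four regimes, read off from the real eigenvalues [r1] and [r2] *)

Theorem theorem5 (R : realType) (k l : nat)
    (beta gamma delta eps : R) (B C D E : nat -> R)
    (k_gt0 : (0 < k)%N) (l_gt0 : (0 < l)%N)
    (beta_ge0 : 0 <= beta) (gamma_ge0 : 0 <= gamma)
    (delta_ge0 : 0 <= delta) (eps_ge0 : 0 <= eps)
    (BCDE_ge0 : forall j : nat, (1 <= j <= l)%N ->
       [/\ 0 <= B j, 0 <= C j, 0 <= D j & 0 <= E j])
    (BCDE_eq0 : forall j : nat, (1 <= j <= l)%N -> (k %| j)%N ->
       [/\ B j = 0, C j = 0, D j = 0 & E j = 0]) :
  let A := mx22 beta gamma delta eps in
  let solution := is_solution k l beta gamma delta eps B C D E in
  [/\ (* (I) *)
      spectral_radius A < 1 ->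
      forall x y : int -> R, solution x y ->
        converges_to x y (fun=> 0) (fun=> 0),
      (* (II) *)
      spectral_radius A = 1 ->
      (forall lam : R[i], eigenvalue (complexify A) lam -> `|lam| = 1 ->
         alg_mult A lam = geom_mult A lam) ->
      ~~ eigenvalue (complexify A) (-1) ->
      (forall x y : int -> R, solution x y ->
         exists x' y' : int -> R,
           [/\ solution x' y', has_period k l k x' y' &
               converges_to x y x' y']) /\
      (exists x y : int -> R, solution x y /\ has_prime_period k l k x y),
      (* (III) *)
      spectral_radius A = 1 ->
      (forall lam : R[i], eigenvalue (complexify A) lam -> `|lam| = 1 ->
         alg_mult A lam = geom_mult A lam) ->
      eigenvalue (complexify A) (-1) ->
      (forall x y : int -> R, solution x y ->
         exists x' y' : int -> R,
           [/\ solution x' y', has_period k l (2 * k) x' y' &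
               converges_to x y x' y']) /\
      (exists x y : int -> R,
         solution x y /\ has_prime_period k l (2 * k) x y)
    & (* (IV) *)
      (1 < spectral_radius A \/
       (spectral_radius A = 1 /\
        exists lam : R[i],
          [/\ eigenvalue (complexify A) lam, `|lam| = 1 &
              (geom_mult A lam < alg_mult A lam)%N])) ->
      exists x y : int -> R, solution x y /\ unbounded_sum k l x y].
Proof.
move=> A solution.
have [r1 [r2 [tr dt r21 br1 er1]]] :=
  mx22_eigenvalues_ex beta_ge0 gamma_ge0 delta_ge0 eps_ge0.
have -> : spectral_radius A = r1 by exact: spectral_radius_mx22 tr dt r21.
have [v1 [v2 [v10 v20 v_gt0 Av1 Av2]]] :=
  perron_vector gamma_ge0 delta_ge0 tr dt br1 er1.
have eigenvalueA lam := eigenvalue_complexify lam tr dt.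
have alg_multA lam := alg_mult_complexify lam tr dt.
have := r21; rewrite ler_norml => /andP[r2_ge r2_le].
have real1 : 1%:C = 1 :> R[i] by rewrite rmorph1.
have realN1 : (-1)%:C = -1 :> R[i] by rewrite rmorphN1.
split.
- move=> r1_lt1 x y sol.
  apply: (solution_cvg0 _ _ _ _ _ _ sol) => //.
  + exact: le_lt_trans br1 r1_lt1.
  + exact: le_lt_trans er1 r1_lt1.
  (* This product is the determinant of [I - A]. *)
  + have : 0 < (1 - r1) * (1 - r2).
      by apply: mulr_gt0; rewrite subr_gt0// (le_lt_trans r2_le).
    by lra.
- move=> r1E semisimple not_m1; split=> [x y sol|]; last first.
    exists (spread k (fun=> v1)), (spread k (fun=> v2)); split.
      by apply: spread_solution => // m _; rewrite Av1 Av2 r1E !mul1r.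
    exact: spread_prime_period.
  have r2_neqN1 : r2 != -1.
    by apply: contraNneq not_m1 => r2E; rewrite eigenvalueA r2E realN1 eqxx orbT.
  have r2_gtN1 : -1 < r2 by rewrite lt_neqAle eq_sym r2_neqN1 -r1E.
  have cvg_k n : cvgn (along k x n) /\ cvgn (along k y n).
    apply: (solution_cvgn_power_bounded _ _ _ _ _ _ _ _ _ _ _ sol) => //.
    + by move: tr dt; rewrite r1E; lra.
    + by rewrite -r1E.
    + by rewrite -r1E.
    + by rewrite -tr r1E; lra.
    (* Trace 2 makes 1 a double eigenvalue, and semisimplicity then gives it a full eigenspace. *)
    + move=> tr2; have r2E : r2 = 1 by move: tr; rewrite r1E; lra.
      have [] // := @geom_mult_full R beta gamma delta eps 1.
      rewrite real1 -semisimple ?normr1//; last first.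
        by rewrite eigenvalueA r1E real1 eqxx.
      by rewrite alg_multA r1E r2E real1 eqxx.
  by apply: (solution_cvg_periodic _ _ _ _ _ _ sol) => // n; case: (cvg_k n).
- move=> r1E _ ev_m1.
  have r2E : r2 = -1.
    move: ev_m1; rewrite eigenvalueA -realN1 => /orP[] /eqP/complexI// r1N1.
    by move: r1E; rewrite -r1N1; lra.
  (* The trace [r1 + r2] is 0 and the diagonal entries are nonnegative. *)
  have [beta0 eps0] : beta = 0 /\ eps = 0 by split; lra.
  have gd1 : gamma * delta = 1.
    by move: dt; rewrite beta0 r1E r2E; lra.
  split=> [x y sol|].
    have sol' := is_solution_swap sol.
    apply: (solution_cvg_periodic _ _ _ _ _ _ sol) => // [|n|n].
    + by rewrite muln_gt0.
    + exact: (solution_cvgn_swapping _ _ _ _ _ _ sol).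
    + apply: (solution_cvgn_swapping _ _ _ _ _ _ sol') => //; last first.
        by rewrite mulrC.
      by move=> j /BCDE_ge0[].
  (* The orbit of [(1, 0)] under [A] alternates between [(1, 0)] and [(0, delta)]. *)
  exists (spread k (fun m => if (2 %| m)%Z then 1 else 0)),
    (spread k (fun m => if (2 %| m)%Z then 0 else delta)); split.
    apply: spread_solution => // m _; first by case: ifP.
    rewrite beta0 eps0 !mul0r add0r addr0.
    rewrite dvdz2_addr1.
    by case: (2 %| m)%Z; rewrite /= ?mulr0 ?mulr1 ?gd1.
  exact: spread_alternating_prime_period.
- move=> [r1_gt1|[r1E [lam [ev lam1 defective]]]].
    (* The orbit of the Perron vector. At negative indices only nonnegativity matters, so the
       absolute value there is a mere convention. *)
    exists (spread k (fun m => r1 ^+ `|m|%N * v1)),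
      (spread k (fun m => r1 ^+ `|m|%N * v2)); split.
      apply: spread_solution => // m m0.
        by rewrite !mulr_ge0// exprn_ge0// ltW// (lt_trans ltr01).
      by rewrite absz_addr1// !exprSr -!mulrA -Av1 -Av2; split; ring.
    apply: (@spread_unbounded _ _ _ k_gt0 _ _ ((r1 - 1) * (v1 + v2))).
      by rewrite mulr_gt0// subr_gt0.
    move=> m; rewrite -mulrDr mulrAC ler_wpM2r ?(ltW v_gt0)//.
    exact/le_expr_bernoulli/ltW.
  (* The geometric multiplicity is at least 1, so the algebraic one is 2 and both eigenvalues equal
     [lam]. *)
  have [r1_lam r2_lam] : r1%:C = lam /\ r2%:C = lam.
    have := defective; have := geom_mult_gt0 ev; rewrite alg_multA.
    by case: (geom_mult _ _) => // n _; case: eqP; case: eqP.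
  have r2E : r2 = 1 by rewrite -r1E; apply: complexI; rewrite r1_lam.
  have [beta1 eps1] : beta = 1 /\ eps = 1 by split; lra.
  have gd0 : gamma * delta = 0 by move: dt; rewrite r1E r2E beta1 eps1; lra.
  have gd_gt0 : 0 < gamma + delta.
    rewrite lt0r addr_ge0// andbT; apply: contraL defective => /eqP gd.
    have [g0 d0] : gamma = 0 /\ delta = 0 by split; lra.
    rewrite -leqNgt alg_multA r1_lam r2_lam eqxx -r1_lam r1E.
    by rewrite /A beta1 eps1 g0 d0 geom_mult_scalar.
  (* Here [A = I + N] with [N] off-diagonal and [N^2 = 0], so this is the orbit of [(1, 1)] under
     [A^m = I + m N]. *)
  exists (spread k (fun m => 1 + gamma * `|m|%N%:R)),
    (spread k (fun m => 1 + delta * `|m|%N%:R)); split.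
    apply: spread_solution => // m m0.
      by split; rewrite addr_ge0// mulr_ge0.
    rewrite absz_addr1// beta1 eps1 !mulrDr !mulrA gd0 [delta * gamma]mulrC gd0.
    by rewrite -natr1 !mulr1 !mul1r !mul0r; split; ring.
  apply: (spread_unbounded k_gt0 gd_gt0) => m; rewrite mulrDl absz_nat.
  by rewrite addrACA lerDr addr_ge0.
Qed.
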